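(* Let $m\in\mathbb N$ with $m\ge 12$ and $i,j\in\{1,2\}$. Then $r(T_m^i,T_{m+1}^j)=r(T_m^*,T_{m+1}^j)=2m-5$.
   Context: All graphs are finite and simple; a graph ''contains'' $H$ if it has a subgraph isomorphic to $H$. For graphs $G_1,G_2$, the Ramsey number $r(G_1,G_2)$ is the smallest positive integer $N$ such that for every graph $G$ on $N$ vertices, either $G$ contains a copy of $G_1$ or the complement $\overline G$ contains a copy of $G_2$. For $n\ge 5$, $T_n^1$ is the tree with vertex set $\{v_0,\ldots,v_{n-1}\}$ and edges $v_0v_1,\ldots,v_0v_{n-3},v_{n-4}v_{n-2},v_{n-3}v_{n-1}$, and $T_n^2$ is the tree on the same vertex set with edges $v_0v_1,\ldots,v_0v_{n-3},v_{n-3}v_{n-2},v_{n-3}v_{n-1}$. For $n\ge 4$, $T_n^*$ is the tree on $\{v_0,\ldots,v_{n-1}\}$ with edges $v_0v_1,\ldots,v_0v_{n-3},v_{n-3}v_{n-2},v_{n-2}v_{n-1}$. *)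

(* Defs.v *)
From mathcomp Require Import all_boot.
Set Implicit Arguments. Unset Strict Implicit. Unset Printing Implicit Defensive.

Definition simple_graph (N : nat) (G : rel 'I_N) : Prop :=
  (forall x y, G x y = G y x) /\ (forall x, G x x = false).

Definition compl (N : nat) (G : rel 'I_N) : rel 'I_N :=
  fun x y => (x != y) && ~~ G x y.

Definition contains (N n : nat) (G : rel 'I_N) (H : rel 'I_n) : Prop :=
  exists f : 'I_n -> 'I_N, injective f /\ forall x y, H x y -> G (f x) (f y).

Definition ramsey_prop (n1 n2 : nat) (G1 : rel 'I_n1) (G2 : rel 'I_n2) (N : nat) : Prop :=
  forall G : rel 'I_N, simple_graph G -> contains G G1 \/ contains (compl G) G2.

Definition is_ramsey_number (n1 n2 : nat) (G1 : rel 'I_n1) (G2 : rel 'I_n2) (N : nat) : Prop :=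
  0 < N /\ ramsey_prop G1 G2 N /\ (forall M, 0 < M -> M < N -> ~ ramsey_prop G1 G2 M).

Definition sym_edges (n : nat) (a : nat -> nat -> bool) : rel 'I_n :=
  fun x y => a x y || a y x.

Definition T1 (n : nat) : rel 'I_n := @sym_edges n (fun u v =>
  [|| (u == 0) && (1 <= v <= n - 3),
      (u == n - 4) && (v == n - 2)
    | (u == n - 3) && (v == n - 1)]).

Definition T2 (n : nat) : rel 'I_n := @sym_edges n (fun u v =>
  [|| (u == 0) && (1 <= v <= n - 3),
      (u == n - 3) && (v == n - 2)
    | (u == n - 3) && (v == n - 1)]).

Definition Tstar (n : nat) : rel 'I_n := @sym_edges n (fun u v =>
  [|| (u == 0) && (1 <= v <= n - 3),
      (u == n - 3) && (v == n - 2)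
    | (u == n - 2) && (v == n - 1)]).

Definition Ti (i n : nat) : rel 'I_n := if i == 1 then @T1 n else @T2 n.

(* Main.v *)
(** Let N = 2m - 5. The degrees of a vertex in G and in the complement of G add
    up to 2m - 6 = (m - 4) + (m - 2). If every degree in the complement is at
    least m - 2, then, for a vertex v, either v has complement degree >= m, or
    counting the edges between its neighbourhood and the rest gives two
    neighbours of v with two neighbours each in the rest; in both cases the
    complement contains T_{m+1}^j. Otherwise some v has degree d >= m - 3 in G.
    Let W be the set of non-neighbours of v. If G avoids the tree on m vertices,
    then (separating the cases d >= m - 1, d = m - 2, d = m - 3) there are very few
    edges leaving the neighbourhood of v, so the complement has a vertex of
    degree >= m with two neighbours of degree >= 4, or is nearly complete
    bipartite between the neighbourhood of v and W; either way it contains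
    T_{m+1}^j. For the lower bound, take K_{m-3,m-3} minus a perfect matching: its
    degrees are m - 4, and m - 3 in the complement. *)
Require Import Defs.
From mathcomp Require Import zify.
From mathcomp Require Import all_boot.
Set Implicit Arguments. Unset Strict Implicit. Unset Printing Implicit Defensive.

(* Elaboration produces cardinals that are convertible but not syntactically
   equal, which lia would treat as distinct atoms: they are named first. *)
Ltac nlia :=
  repeat match goal with
  | H : is_true (leq _ _) |- _ => revert H
  | H : @eq nat _ _ |- _ => revert H
  end;
  cbn [size];
  repeat match goal with |- context [@card.body ?T ?X] =>
    let d := fresh "d" in (set d := (@card.body T X)); clearbody d end;
  repeat match goal with |- context [@size ?T ?X] =>
    let d := fresh "d" in (set d := (@size T X)); clearbody d end;
  clear; intros; lia.

Ltac distinct :=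
  rewrite /= !inE !negb_or; repeat (apply/andP; split);
  first [done | by rewrite eq_sym].

(** * Embedding the three trees around a centre *)

Definition nb (N : nat) (R : rel 'I_N) (v : 'I_N) : {set 'I_N} := [set x | R v x].

Lemma ex_notin (T : finType) (A : {set T}) (s : seq T) :
  size s < #|A| -> exists2 x, x \in A & x \notin s.
Proof.
move=> lt_sA; apply/subsetPn; apply: contraTN lt_sA => /subset_leq_card le_As.
by rewrite -leqNgt (leq_trans le_As) ?card_size.
Qed.

Lemma card_setD_seq (T : finType) (A : {set T}) (s : seq T) :
  #|A| <= #|A :\: [set x in s]| + size s.
Proof.
rewrite -(cardsID [set x in s] A) addnC leq_add2l.
apply: leq_trans (subset_leq_card (subsetIr _ _)) _.
by rewrite cardsE card_size.
Qed.

Lemma contains_seq (N n : nat) (R : rel 'I_N) (a : nat -> nat -> bool) (x0 : 'I_N) s :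
  simple_graph R -> uniq s -> size s = n ->
  (forall i j, i < n -> j < n -> a i j -> R (nth x0 s i) (nth x0 s j)) ->
  contains R (@sym_edges n a).
Proof.
move=> [symR _] Us sz_s aR; exists (fun i => nth x0 s i); split=> [i j /eqP|i j].
  by rewrite nth_uniq ?sz_s // => /eqP/val_inj.
by case/orP=> /aR H; [|rewrite symR]; apply: H.
Qed.

(** Shared by the three trees: [c] is the centre, [s] its non-leaf neighbours, [t] the vertices
    further away. Putting the leaves [L] before [s] makes [c :: L ++ s ++ t] follow the numbering of
    the tree. The bound n - 3 counts [s] and [L] together. *)
Lemma star_seq (N n k : nat) (R : rel 'I_N) c (s t : seq 'I_N) :
  uniq (c :: s ++ t) -> ~~ R c c -> size s + k = n - 3 ->
  {in s, forall x, R c x} -> n - 3 <= #|nb R c :\: [set x in t]| ->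
  exists L, [/\ size L = k, uniq (c :: L ++ s ++ t) & {in L, forall x, R c x}].
Proof.
move=> U Rcc sz Rs; set A := _ :\: _ => leA.
pose L0 := enum (A :\: [set x in s]).
have LP x : x \in L0 -> [/\ R c x, x \notin s & x \notin t].
  by rewrite mem_enum !inE => /and3P[-> -> ->].
have szL : k <= size L0.
  by rewrite -cardE; have := card_setD_seq A s; nlia.
exists (take k L0); split; first by rewrite size_takel.
  move: U; rewrite 2!cons_uniq => /andP[cst Ust]; rewrite mem_cat negb_or cst.
  rewrite [uniq (take _ _ ++ _)]cat_uniq Ust take_uniq ?enum_uniq // !andbT; apply/andP; split.
    by apply/negP=> /mem_take/LP[Rc]; rewrite Rc in Rcc.
  apply/hasPn=> x; rewrite mem_cat; apply: contraL => /mem_take/LP[_ xs xt].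
  by rewrite negb_or xs.
by move=> x /mem_take/LP[].
Qed.

Lemma contains_T1 (N n : nat) (R : rel 'I_N) c a b a' b' :
  simple_graph R -> 5 <= n -> uniq [:: c; a; b; a'; b'] ->
  R c a -> R c b -> R a a' -> R b b' ->
  n - 3 <= #|nb R c :\: [set x in [:: a'; b']]| -> contains R (@T1 n).
Proof.
move=> sR n5 U Rca Rcb Raa Rbb le_n.
have [_ irR] := sR.
have [|||L [szL UL LR]] := @star_seq N n (n - 5) R c [:: a; b] [:: a'; b'] U _ _ _ le_n.
- by rewrite irR.
- rewrite /=; nlia.
- by move=> x; rewrite !inE => /orP[] /eqP->.
apply: (contains_seq (x0 := c) sR UL); first by rewrite /= size_cat /= szL; nlia.
move=> i j lti ltj /or3P[/andP[/eqP-> /andP[j1 j2]]|/andP[/eqP-> /eqP->]|/andP[/eqP-> /eqP->]].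
- case: j j1 ltj j2 => // j _ ltj j2 /=; rewrite nth_cat szL.
  case: ltnP => lj; first by apply/LR/mem_nth; rewrite szL.
  have /orP[/eqP->|/eqP->] : (j - (n - 5) == 0) || (j - (n - 5) == 1) by nlia.
  + by [].
  + by [].
- have -> : n - 4 = (n - 5).+1 by nlia.
  have -> : n - 2 = (n - 5 + 2).+1 by nlia.
  by rewrite /= !nth_cat szL ltnn subnn ifF ?addKn //; nlia.
- have -> : n - 3 = (n - 5 + 1).+1 by nlia.
  have -> : n - 1 = (n - 5 + 3).+1 by nlia.
  by rewrite /= !nth_cat szL !ifF ?addKn //; nlia.
Qed.

Lemma contains_T2 (N n : nat) (R : rel 'I_N) c a a' b' :
  simple_graph R -> 5 <= n -> uniq [:: c; a; a'; b'] ->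
  R c a -> R a a' -> R a b' ->
  n - 3 <= #|nb R c :\: [set x in [:: a'; b']]| -> contains R (@T2 n).
Proof.
move=> sR n5 U Rca Raa Rab le_n.
have [_ irR] := sR.
have [|||L [szL UL LR]] := @star_seq N n (n - 4) R c [:: a] [:: a'; b'] U _ _ _ le_n.
- by rewrite irR.
- rewrite /=; nlia.
- by move=> x; rewrite !inE => /eqP->.
apply: (contains_seq (x0 := c) sR UL); first by rewrite /= size_cat /= szL; nlia.
move=> i j lti ltj /or3P[/andP[/eqP-> /andP[j1 j2]]|/andP[/eqP-> /eqP->]|/andP[/eqP-> /eqP->]].
- case: j j1 ltj j2 => // j _ ltj j2 /=; rewrite nth_cat szL.
  case: ltnP => lj; first by apply/LR/mem_nth; rewrite szL.
  by have -> : j - (n - 4) = 0 by nlia.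
- have -> : n - 3 = (n - 4).+1 by nlia.
  have -> : n - 2 = (n - 4 + 1).+1 by nlia.
  by rewrite /= !nth_cat szL ltnn subnn ifF ?addKn //; nlia.
- have -> : n - 3 = (n - 4).+1 by nlia.
  have -> : n - 1 = (n - 4 + 2).+1 by nlia.
  by rewrite /= !nth_cat szL ltnn subnn !ifF ?addKn //; nlia.
Qed.

Lemma contains_Tstar (N n : nat) (R : rel 'I_N) c a a' b' :
  simple_graph R -> 5 <= n -> uniq [:: c; a; a'; b'] ->
  R c a -> R a a' -> R a' b' ->
  n - 3 <= #|nb R c :\: [set x in [:: a'; b']]| -> contains R (@Tstar n).
Proof.
move=> sR n5 U Rca Raa Rab le_n.
have [_ irR] := sR.
have [|||L [szL UL LR]] := @star_seq N n (n - 4) R c [:: a] [:: a'; b'] U _ _ _ le_n.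
- by rewrite irR.
- rewrite /=; nlia.
- by move=> x; rewrite !inE => /eqP->.
apply: (contains_seq (x0 := c) sR UL); first by rewrite /= size_cat /= szL; nlia.
move=> i j lti ltj /or3P[/andP[/eqP-> /andP[j1 j2]]|/andP[/eqP-> /eqP->]|/andP[/eqP-> /eqP->]].
- case: j j1 ltj j2 => // j _ ltj j2 /=; rewrite nth_cat szL.
  case: ltnP => lj; first by apply/LR/mem_nth; rewrite szL.
  by have -> : j - (n - 4) = 0 by nlia.
- have -> : n - 3 = (n - 4).+1 by nlia.
  have -> : n - 2 = (n - 4 + 1).+1 by nlia.
  by rewrite /= !nth_cat szL ltnn subnn ifF ?addKn //; nlia.
- have -> : n - 2 = (n - 4 + 1).+1 by nlia.
  have -> : n - 1 = (n - 4 + 2).+1 by nlia.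
  by rewrite /= !nth_cat szL !ifF ?addKn //; nlia.
Qed.

(** * Sufficient conditions for T_n^1 and T_n^2 *)

(** Greedy choice: the two vertices at distance two cost the centre at most two of its n - 1
    neighbours, and degree 4 leaves a fresh [b'] after avoiding [c], [a] and [a']. *)
Lemma contains_Ti_deg (N n j : nat) (R : rel 'I_N) c a b :
  simple_graph R -> 5 <= n -> a != b -> R c a -> R c b ->
  n.-1 <= #|nb R c| -> 4 <= #|nb R a| -> 4 <= #|nb R b| -> contains R (@Ti j n).
Proof.
move=> sR n5 ab Rca Rcb dc da db; have [symR irR] := sR.
have lc s : size s = 2 -> n - 3 <= #|nb R c :\: [set x in s]|.
  by move=> sz; have := card_setD_seq (nb R c) s; nlia.
have Rne x y : R x y -> x != y by apply: contraTneq => ->; rewrite irR.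
rewrite /Ti; case: ifP => _.
  have [a'] := @ex_notin _ (nb R a) [:: c; b] (ltnW da).
  rewrite !inE negb_or => Raa /andP[a'c a'b].
  have [b'] := @ex_notin _ (nb R b) [:: c; a; a'] db.
  rewrite !inE !negb_or => Rbb /and3P[b'c b'a b'a'].
  apply: (@contains_T1 N n R c a b a' b') => //; last exact: lc.
  rewrite /= !inE !negb_or !(Rne _ _ Rca, Rne _ _ Rcb, Rne _ _ Raa, Rne _ _ Rbb) ab.
  by rewrite ![c == _]eq_sym ![b == a']eq_sym ![a == b']eq_sym ![a' == b']eq_sym a'c b'c b'a a'b b'a'.
have [a'] := @ex_notin _ (nb R a) [:: c] (ltnW (ltnW da)).
rewrite !inE => Raa a'c.
have [b'] := @ex_notin _ (nb R a) [:: c; a'] (ltnW da).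
rewrite !inE !negb_or => Rbb /andP[b'c b'a'].
apply: (@contains_T2 N n R c a a' b') => //; last exact: lc.
rewrite /= !inE !negb_or !(Rne _ _ Rca, Rne _ _ Raa, Rne _ _ Rbb).
by rewrite ![c == _]eq_sym ![a' == b']eq_sym a'c b'c b'a'.
Qed.

(** The vertices at distance two are taken outside [c |: D], so [D] stays intact and n - 3
    neighbours suffice. T_n^1 uses one outside neighbour of each of [a] and [b], two choices making
    them distinct; T_n^2 uses two of [a]. *)
Lemma contains_Ti_out (N n j : nat) (R : rel 'I_N) c a b (D : {set 'I_N}) :
  simple_graph R -> 5 <= n -> a != b -> a \in D -> b \in D -> D \subset nb R c ->
  n - 3 <= #|D| -> 2 <= #|nb R a :\: (c |: D)| -> 2 <= #|nb R b :\: (c |: D)| ->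
  contains R (@Ti j n).
Proof.
move=> sR n5 ab aD bD sD dD da db; have [symR irR] := sR.
have RD x : x \in D -> R c x by move/(subsetP sD); rewrite inE.
have Rne x y : R x y -> x != y by apply: contraTneq => ->; rewrite irR.
have lc x y : x \notin D -> y \notin D -> n - 3 <= #|nb R c :\: [set z in [:: x; y]]|.
  move=> xD yD; apply: leq_trans dD (subset_leq_card _).
  rewrite subsetD sD; apply/pred0P=> z /=; rewrite !inE.
  by apply/negP=> /andP[zD /orP[] /eqP E]; [move: xD|move: yD]; rewrite -E zD.
have [Rca Rcb] := (RD _ aD, RD _ bD).
have [a'] := @ex_notin _ (nb R a :\: (c |: D)) [::] (ltnW da).
rewrite !inE negb_or => /andP[/andP[a'c a'D] Raa] _.
have Da x : x \in D -> x != a' by apply: contraTneq => ->.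
rewrite /Ti; case: ifP => _.
  have [b'] := @ex_notin _ (nb R b :\: (c |: D)) [:: a'] db.
  rewrite !inE negb_or => /andP[/andP[b'c b'D] Rbb] b'a'.
  have Db x : x \in D -> x != b' by apply: contraTneq => ->.
  apply: (@contains_T1 N n R c a b a' b') => //; last exact: lc.
  rewrite /= !inE !negb_or !(Rne _ _ Rca, Rne _ _ Rcb) ab ![c == _]eq_sym a'c b'c.
  by rewrite (Da a) // (Da b) // (Db a) // (Db b) // eq_sym b'a'.
have [b'] := @ex_notin _ (nb R a :\: (c |: D)) [:: a'] da.
rewrite !inE negb_or => /andP[/andP[b'c b'D] Rbb] b'a'.
apply: (@contains_T2 N n R c a a' b') => //; last exact: lc.
have Db x : x \in D -> x != b' by apply: contraTneq => ->.
rewrite /= !inE !negb_or !(Rne _ _ Rca) ![c == _]eq_sym a'c b'c.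
by rewrite (Da a) // (Db a) // eq_sym b'a'.
Qed.

(** The centre is [u], with [y |: Q] as [D]. Any [a] and [b] in [Q] see all of [P], of which at
    least two vertices differ from [u] and [y]. The vertex [y] lets [Q] be one short of n - 3. *)
Lemma contains_Ti_bip (N n j : nat) (R : rel 'I_N) (P Q : {set 'I_N}) u y :
  simple_graph R -> 7 <= n -> {in P & Q, forall p q, R p q} -> u \in P -> R u y ->
  n - 3 <= #|y |: Q| -> 4 <= #|P| -> contains R (@Ti j n).
Proof.
move=> sR n7 PQ uP Ruy dQ dP; have [symR irR] := sR.
have lQ : 2 < #|Q| by move: dQ; rewrite cardsU1; case: (y \notin Q) => /=; nlia.
have [a aQ _] := @ex_notin _ Q [::] (ltnW (ltnW lQ)).
have [b bQ] := @ex_notin _ Q [:: a] (ltnW lQ); rewrite inE eq_sym => ab.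
have out x : x \in Q -> 1 < #|nb R x :\: (u |: (y |: Q))|.
  move=> xQ; have h : 2 <= #|P :\: [set z in [:: u; y]]|.
    by have := card_setD_seq P [:: u; y] => /=; nlia.
  apply: leq_trans h (subset_leq_card _); apply/subsetP=> z; rewrite !inE !negb_or.
  case/andP=> /andP[-> ->] zP; rewrite symR PQ // andbT /=.
  by apply/negP=> zQ; have := PQ _ _ zP zQ; rewrite irR.
apply: (@contains_Ti_out N n j R u a b (y |: Q)) => //; try exact: out.
- exact: leq_trans n7.
- by rewrite !inE aQ orbT.
- by rewrite !inE bQ orbT.
by apply/subsetP=> z; rewrite !inE => /orP[/eqP->//|]; apply: PQ.
Qed.

(** * Complements and double counting *)

Lemma compl_simple (N : nat) (G : rel 'I_N) : simple_graph G -> simple_graph (compl G).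
Proof.
by case=> symG _; split=> [x y|x]; rewrite /compl ?eqxx // eq_sym symG.
Qed.

Lemma card_nb_compl (N : nat) (G : rel 'I_N) v :
  simple_graph G -> #|nb G v| + #|nb (compl G) v| = N.-1.
Proof.
case=> symG irG; have := cardsC1 v; rewrite card_ord => <-.
rewrite -(cardsID (nb G v) [set~ v]); congr (_ + _); apply: eq_card => x.
  by rewrite !inE andbC; case: eqVneq => [->|]; rewrite ?irG ?andbT.
by rewrite !inE /compl eq_sym andbC.
Qed.

Lemma card_nb_out (N : nat) (G : rel 'I_N) v :
  simple_graph G -> #|~: (v |: nb G v)| + #|nb G v| = N.-1.
Proof.
case=> symG irG; have := cardsCs (v |: nb G v); rewrite cardsU1 card_ord inE irG /=.
have := max_card [in v |: nb G v]; have := max_card [in ~: (v |: nb G v)].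
rewrite card_ord; nlia.
Qed.

Lemma card_nb_sum (N : nat) (R : rel 'I_N) (A : {set 'I_N}) v :
  #|nb R v :&: A| = \sum_(x in A) R v x.
Proof.
rewrite -sum1_card (eq_bigl (fun x => (x \in A) && R v x)); last first.
  by move=> x; rewrite !inE andbC.
by rewrite big_mkcondr; apply: eq_bigr => x _; case: (R v x).
Qed.

Lemma sum_card_nb (N : nat) (R : rel 'I_N) (A B : {set 'I_N}) : simple_graph R ->
  \sum_(x in A) #|nb R x :&: B| = \sum_(y in B) #|nb R y :&: A|.
Proof.
case=> symR _; under eq_bigr do rewrite card_nb_sum.
by rewrite exchange_big; apply: eq_bigr => y _; rewrite card_nb_sum; apply: eq_bigr => x _; rewrite symR.
Qed.

(** At least 3|W| edges join [W] to [A]. If at most one vertex of [A] had two or more neighbours in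
    [W], there would be at most |W| + |A| < 3|W| of them. *)
Lemma two_heavy (N : nat) (R : rel 'I_N) (A W : {set 'I_N}) : simple_graph R ->
  (forall w, w \in W -> 3 <= #|nb R w :&: A|) -> #|A| < 2 * #|W| ->
  exists a b, [/\ a \in A, b \in A, a != b, 2 <= #|nb R a :&: W| & 2 <= #|nb R b :&: W|].
Proof.
move=> sR degW AW; pose Y := [set a in A | 2 <= #|nb R a :&: W|].
suff /card_gt1P[a [b [aY bY ab]]] : 1 < #|Y|.
  by exists a, b; move: aY bY; rewrite !inE => /andP[-> ->] /andP[-> ->].
have le1 : 3 * #|W| <= \sum_(w in W) #|nb R w :&: A|.
  by rewrite mulnC -sum_nat_const; apply: leq_sum.
have le2 : \sum_(a in A) #|nb R a :&: W| <= \sum_(a in A) ((a \in Y) * #|W| + 1).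
  apply: leq_sum => a aA; rewrite !inE aA /=; case: ltnP => h; last by rewrite addn1; nlia.
  by rewrite mul1n (leq_trans (subset_leq_card (subsetIr _ _))) ?leq_addr.
have eq3 : \sum_(a in A) ((a \in Y) * #|W| + 1) = #|Y| * #|W| + #|A|.
  rewrite big_split /= -big_distrl /= sum1_card; congr (_ * _ + _).
  rewrite -sum1_card [RHS](eq_bigl (fun x => (x \in A) && (x \in Y))) => [|x].
    by rewrite big_mkcondr; apply: eq_bigr => x _; case: (_ \in _).
  by rewrite !inE; case: (_ \in A).
rewrite sum_card_nb // eq3 in le2; have := leq_trans le1 le2.
rewrite ltnNge; move=> h; apply/negP=> hY.
have := leq_mul hY (leqnn #|W|); move: h; rewrite mul1n; nlia.
Qed.

(** * Forcing the larger tree in the complement *)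

Lemma contains_Ti_min_degree (N n j : nat) (R : rel 'I_N) :
  simple_graph R -> 13 <= n -> N = 2 * n - 7 ->
  (forall v, n - 3 <= #|nb R v|) -> contains R (@Ti j n).
Proof.
move=> sR n13 eN dR; have [symR irR] := sR.
have [v _] : {v : 'I_N | true} by have N0 : 0 < N by [nlia]; exists (Ordinal N0).
have dv := dR v; set D := nb R v in dv *; have cW := card_nb_out v sR.
set W := ~: _ in cW; case: (leqP n.-1 #|D|) => leD.
  have [|a aD _] := @ex_notin _ D [::]; first by rewrite /=; nlia.
  have [|b bD] := @ex_notin _ D [:: a]; first by rewrite /=; nlia.
  rewrite !inE eq_sym in aD bD * => ab.
  apply: (@contains_Ti_deg N n j R v a b) => //; first by nlia.
    by apply: leq_trans (dR a); nlia.
  by apply: leq_trans (dR b); nlia.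
(* Since |D| >= n - 3, [W] has at most n - 5 vertices, so [w] has at most n - 6 neighbours in [W]
   and hence at least 3 in [D]. *)
have degW w : w \in W -> 3 <= #|nb R w :&: D|.
  move=> wW; have := cardsID D (nb R w); have := dR w.
  suff /subset_leq_card : nb R w :\: D \subset W :\ w.
    by have := cardsD1 w W; rewrite wW; rewrite -/D in cW; nlia.
  apply/subsetP=> x; rewrite !inE => /andP[xD Rwx]; rewrite negb_or xD andbT.
  move: wW; rewrite !inE negb_or => /andP[_ vw].
  by apply/andP; split; apply: contraTneq Rwx => ->; rewrite ?irR // symR.
have [|a [b [aD bD ab da db]]] := two_heavy sR degW; first by rewrite -/D in cW; nlia.
by apply: (@contains_Ti_out N n j R v a b D) => //; rewrite ?setDE //; nlia.
Qed.

(** Degrees in [G] and its complement add up to 2m - 6: the bound m - 6 gives [c] complement degree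
    at least m, and 2m - 10 gives the vertices of [S] at least 4. The 3 leaves room for [a] and [b]
    once [c] and its neighbours are discarded. *)
Lemma contains_Ti_compl_sparse (N m j : nat) (G : rel 'I_N) c (S : {set 'I_N}) :
  simple_graph G -> 12 <= m -> N = 2 * m - 5 ->
  #|nb G c| <= m - 6 -> #|nb G c| + 3 <= #|S| ->
  (forall x, x \in S -> #|nb G x| <= 2 * m - 10) -> contains (compl G) (@Ti j m.+1).
Proof.
move=> sG m12 eN dc lS dS; have sH := compl_simple sG.
have [|a aS] := @ex_notin _ S (c :: enum (nb G c)); first by rewrite /= -cardE; nlia.
rewrite !inE mem_enum inE negb_or => /andP[ac Gca].
have [|b bS] := @ex_notin _ S [:: a, c & enum (nb G c)]; first by rewrite /= -cardE; nlia.
rewrite !inE mem_enum inE !negb_or => /and3P[ba bc Gcb].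
have deg x : #|nb G x| <= 2 * m - 10 -> 4 <= #|nb (compl G) x|.
  by have := card_nb_compl x sG; nlia.
apply: (@contains_Ti_deg N m.+1 j (compl G) c a b) => //; try by apply/deg/dS.
- by nlia.
- by rewrite eq_sym.
- by rewrite /compl eq_sym ac.
- by rewrite /compl eq_sym bc.
- by have := card_nb_compl c sG; nlia.
Qed.

(** The complement joins all m - 4 vertices of [W] to the m - 1 vertices of [v |: nb G v]. *)
Lemma contains_Ti_compl_sep (N m j : nat) (G : rel 'I_N) v :
  simple_graph G -> 12 <= m -> N = 2 * m - 5 -> #|nb G v| = m - 2 ->
  (forall x w, G v x -> w \notin v |: nb G v -> ~~ G x w) ->
  contains (compl G) (@Ti j m.+1).
Proof.
move=> sG m12 eN dv noE; have sH := compl_simple sG; have [symG irG] := sG.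
have cW := card_nb_out v sG; set W := ~: _ in cW.
have [|u uW _] := @ex_notin _ W [::]; first by rewrite /=; nlia.
have WQ : {in W & v |: nb G v, forall p q, compl G p q}.
  move=> w x; rewrite inE => wW xQ; rewrite /compl; apply/andP; split.
    by apply: contraNneq wW => ->.
  move: xQ; rewrite !inE => /orP[/eqP->|Gvx]; last by rewrite symG noE.
  by move: wW; rewrite !inE negb_or symG => /andP[].
apply: (@contains_Ti_bip N m.+1 j (compl G) W (v |: nb G v) u v) => //.
- by nlia.
- by apply: WQ => //; rewrite !inE eqxx.
- by rewrite setUA setUid cardsU1 inE irG /=; nlia.
- by nlia.
Qed.

(** * The tree T_m^1 *)

(** A second branch [v], [x'], [y'] avoiding [x] and [y] completes T_m^1. Without one, a neighbour
    of [v] other than [x] and [y] is adjacent to none but [v], [x], [y], so has degree at most 3. *)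
Lemma contains_T1_hub (N m j : nat) (G : rel 'I_N) v x y :
  simple_graph G -> 12 <= m -> N = 2 * m - 5 ->
  m - 2 <= #|nb G v| -> G v x -> G x y -> y != v ->
  (m - 1 <= #|nb G v|) || ~~ G v y ->
  contains G (@T1 m) \/ contains (compl G) (@Ti j m.+1).
Proof.
move=> sG m12 eN dv Gvx Gxy yv dy; have [symG irG] := sG.
have Gne a b : G a b -> a != b by apply: contraTneq => ->; rewrite irG.
have [/existsP[x' /existsP[y' /and3P[Gvx' Gxy' U]]]|noE] :=
  boolP [exists x', exists y', [&& G v x', G x' y' & uniq [:: v; x; x'; y; y']]].
  left; apply: (@contains_T1 N m G v x x' y y') => //; first by nlia.
  case/orP: dy => dy; first by have := card_setD_seq (nb G v) [:: y; y']; nlia.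
  (* Here [y] is not a neighbour of [v], so only [y'] can be lost. *)
  have := card_setD_seq (nb G v) [:: y'].
  suff /subset_leq_card : nb G v :\: [set x in [:: y']] \subset
    nb G v :\: [set x in [:: y; y']] by nlia.
  apply/subsetP=> z; rewrite !inE negb_or => /andP[-> Gvz]; rewrite Gvz !andbT.
  by apply: contraNneq dy => <-.
have nbS c : c \in nb G v :\: [set z in [:: x; y]] -> nb G c \subset [:: v; x; y].
  rewrite !inE negb_or => /andP[/andP[cx cy] Gvc]; apply/subsetP=> z; rewrite !inE => Gcz.
  apply: contraR noE; rewrite !negb_or => /and3P[zv zx zy].
  apply/existsP; exists c; apply/existsP; exists z; rewrite Gvc Gcz /= !inE !negb_or.
  rewrite (Gne _ _ Gvx) (Gne _ _ Gvc) ![v == _]eq_sym yv zv ![x == _]eq_sym cx zx.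
  by rewrite [y == x]eq_sym (Gne _ _ Gxy) cy (Gne _ _ Gcz) eq_sym zy.
have deg c : c \in nb G v :\: [set z in [:: x; y]] -> #|nb G c| <= 3.
  by move=> /nbS/subset_leq_card/leq_trans; apply; rewrite card_size.
have lS := card_setD_seq (nb G v) [:: x; y].
have [|c cS _] := @ex_notin _ (nb G v :\: [set z in [:: x; y]]) [::]; first by nlia.
right; have dc := deg c cS.
apply: (@contains_Ti_compl_sparse N m j G c (nb G v :\: [set z in [:: x; y]])) => //.
- by nlia.
- by nlia.
- by move=> z /deg h; apply: leq_trans h _; nlia.
Qed.

(** A complement edge from [P] to a vertex outside [Q] gives its end in [P] at least m - 2
    complement neighbours, enough for [contains_Ti_bip]; likewise from [Q]. Without such edges,
    T_m^1 is centred at [c] with one branch in [P] and one in [Q]. *)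
Lemma contains_T1_pair (N m j : nat) (G : rel 'I_N) (P Q : {set 'I_N}) c :
  simple_graph G -> 12 <= m -> #|P| = m - 3 -> #|Q| = m - 3 ->
  c \notin P -> c \notin Q -> {in P & Q, forall p q, compl G p q} ->
  contains G (@T1 m) \/ contains (compl G) (@Ti j m.+1).
Proof.
move=> sG m12 cP cQ Pc Qc PQ; have [symG irG] := sG.
have sH := compl_simple sG; have [symH irH] := sH.
have QP : {in Q & P, forall q p, compl G q p} by move=> q p qQ pP; rewrite symH PQ.
have PnQ x : x \in P -> x \notin Q by move=> xP; apply/negP=> /(PQ _ _ xP); rewrite irH.
have half (P' Q' : {set 'I_N}) u y : #|P'| = m - 3 -> #|Q'| = m - 3 ->
    {in P' & Q', forall p q, compl G p q} -> u \in P' -> compl G u y -> y \notin Q' ->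
    contains (compl G) (@Ti j m.+1).
  move=> cP' cQ' PQ' uP Huy yQ.
  apply: (@contains_Ti_bip N m.+1 j (compl G) P' Q' u y) => //; first by nlia.
    by rewrite cardsU1 yQ; nlia.
  by nlia.
have [/existsP[u /existsP[y /and3P[uP Huy yQ]]]|noP] :=
  boolP [exists u, exists y, [&& u \in P, compl G u y & y \notin Q]].
  by right; apply: (half P Q u y).
have [/existsP[u /existsP[y /and3P[uQ Huy yP]]]|noQ] :=
  boolP [exists u, exists y, [&& u \in Q, compl G u y & y \notin P]].
  by right; apply: (half Q P u y).
(* From here on, c is joined in G to the two cliques P and Q. *)
have GP u y : u \in P -> y \notin Q -> u != y -> G u y.
  move=> uP yQ uy; apply: contraR noP => nG; apply/existsP; exists u; apply/existsP; exists y.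
  by rewrite uP yQ /compl uy nG.
have GQ u y : u \in Q -> y \notin P -> u != y -> G u y.
  move=> uP yQ uy; apply: contraR noQ => nG; apply/existsP; exists u; apply/existsP; exists y.
  by rewrite uP yQ /compl uy nG.
have QnP x : x \in Q -> x \notin P by apply: contraL => /PnQ.
have Pne x : x \in P -> x != c by apply: contraTneq => ->.
have Qne x : x \in Q -> x != c by apply: contraTneq => ->.
have PQne x y : x \in P -> y \in Q -> x != y by move=> xP; apply: contraTneq => <-; apply: PnQ.
have [|a aP _] := @ex_notin _ P [::]; first by nlia.
have [|a' a'P] := @ex_notin _ P [:: a]; first by nlia.
have [|b bQ _] := @ex_notin _ Q [::]; first by nlia.
have [|b' b'Q] := @ex_notin _ Q [:: b]; first by nlia.
rewrite !inE => b'b a'a; left.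
apply: (@contains_T1 N m G c a b a' b') => //.
- exact: leq_trans m12.
- have [ca cb] := (Pne _ aP, Qne _ bQ); have [ca' cb'] := (Pne _ a'P, Qne _ b'Q).
  have [ab ab'] := (PQne _ _ aP bQ, PQne _ _ aP b'Q).
  by have [a'b a'b'] := (PQne _ _ a'P bQ, PQne _ _ a'P b'Q); distinct.
- by rewrite symG GP ?Pne.
- by rewrite symG GQ ?Qne.
- by rewrite GP ?PnQ // eq_sym.
- by rewrite GQ ?QnP // eq_sym.
have : #|P :|: Q| = #|P| + #|Q|.
  rewrite cardsU; suff -> : P :&: Q = set0 by rewrite cards0 subn0.
  by apply/setP=> z; rewrite !inE; apply/negP=> /andP[/PnQ/negP].
have /subset_leq_card : P :|: Q \subset nb G c.
  apply/subsetP=> z; rewrite !inE symG => /orP[zP|zQ]; first by rewrite GP ?Pne.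
  by rewrite GQ ?Qne.
have := card_setD_seq (nb G c) [:: a'; b']; move: m12 cP cQ; clear; nlia.
Qed.

Lemma T1_or_compl (N m j : nat) (G : rel 'I_N) v :
  simple_graph G -> 12 <= m -> N = 2 * m - 5 -> m - 3 <= #|nb G v| ->
  contains G (@T1 m) \/ contains (compl G) (@Ti j m.+1).
Proof.
move=> sG m12 eN dv; have [symG irG] := sG.
have sH := compl_simple sG; have [symH irH] := sH.
have Gne a b : G a b -> a != b by apply: contraTneq => ->; rewrite irG.
have cW := card_nb_out v sG; set W := ~: _ in cW.
have inW w : (w \in W) = (w != v) && ~~ G v w by rewrite !inE negb_or.
have {dv} [dv|dv] : (m - 2 <= #|nb G v|) \/ #|nb G v| = m - 3 by nlia.
  have [/existsP[x /existsP[y /and4P[Gvx Gxy yv dy]]]|noE] := boolP [exists x, exists y,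
    [&& G v x, G x y, y != v & (m - 1 <= #|nb G v|) || ~~ G v y]].
    exact: contains_T1_hub Gvx Gxy yv dy.
  have {}noE x y : G v x -> G x y -> y != v ->
      (m - 1 <= #|nb G v|) || ~~ G v y = false.
    move=> Gvx Gxy yv; apply: contraNF noE => dy.
    by apply/existsP; exists x; apply/existsP; exists y; apply/and4P.
  right; case: (leqP (m - 1) #|nb G v|) => dv1; last first.
    apply: (@contains_Ti_compl_sep N m j G v) => //; first by nlia.
    move=> x w Gvx; rewrite !inE negb_or => /andP[wv nGvw]; apply/negP=> Gxw.
    by have := noE _ _ Gvx Gxw wv; rewrite nGvw orbT.
  have deg x : x \in nb G v -> #|nb G x| <= 1.
    rewrite inE => Gvx; rewrite -(cards1 v); apply/subset_leq_card/subsetP=> z.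
    rewrite !inE => Gxz; apply: contraT => zv.
    by have := noE _ _ Gvx Gxz zv; rewrite dv1.
  have [|c cN _] := @ex_notin _ (nb G v) [::]; first by nlia.
  have dc := deg c cN.
  apply: (@contains_Ti_compl_sparse N m j G c (nb G v)) => //; try by nlia.
  by move=> z /deg h; apply: leq_trans h _; nlia.
(* From here [nb G v] and [W] both have m - 3 vertices. Two disjoint edges between them give T_m^1
   at [v]. Otherwise any two meet, and being edges of a bipartite graph they all share one
   endpoint. *)
pose cross (p : 'I_N * 'I_N) := [&& G v p.1, p.2 \in W & G p.1 p.2].
have [/existsP[[x y] /existsP[[x' y'] /and4P[/and3P[/= Gvx yW Gxy] /and3P[/= Gvx' y'W Gxy'] xx' yy']]]|noM] :=
  boolP [exists p, exists q, [&& cross p, cross q, p.1 != q.1 & p.2 != q.2]].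
  left; move: yW y'W; rewrite !inW => /andP[yv nGvy] /andP[yv' nGvy'].
  apply: (@contains_T1 N m G v x x' y y') => //; first by nlia.
    have [vx vx'] := (Gne _ _ Gvx, Gne _ _ Gvx').
    have [xy xy'] := (Gne _ _ Gxy, Gne _ _ Gxy').
    have x'y : x' != y by apply: contraNneq nGvy => <-.
    have xyy : x != y' by apply: contraNneq nGvy' => <-.
    by distinct.
  rewrite -dv; apply: subset_leq_card; apply/subsetP=> z; rewrite !inE negb_or => Gvz.
  by rewrite Gvz andbT; apply/andP; split; apply: contraTneq Gvz => ->.
have {}noM p q : cross p -> cross q -> (p.1 == q.1) || (p.2 == q.2).
  move=> cp cq; apply: contraR noM; rewrite negb_or => /andP[pq1 pq2].
  by apply/existsP; exists p; apply/existsP; exists q; apply/and4P.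
have Hcross x w : G v x -> w \in W -> ~~ cross (x, w) -> compl G x w.
  rewrite /cross inW => Gvx /andP[wv nGvw]; rewrite Gvx wv nGvw /= /compl => ->.
  by rewrite andbT; apply: contraNneq nGvw => <-.
have Hv w : w \in W -> compl G v w.
  by rewrite inW /compl eq_sym.
have cWm : #|W| = m - 3 by nlia.
have NnW x : G v x -> x \notin W by rewrite inW negb_and => ->; rewrite orbT.
(* Exchanging [c] for [v] turns [nb G v] into a set of m - 3 vertices without edges of [G] to
   [W]. *)
have coverN c : G v c -> (forall p, cross p -> p.1 == c) ->
    contains G (@T1 m) \/ contains (compl G) (@Ti j m.+1).
  move=> Gvc covc; apply: (@contains_T1_pair N m j G (v |: nb G v :\ c) W c) => //.
  - rewrite cardsU1 !inE irG andbF /=; have := cardsD1 c (nb G v).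
    by rewrite inE Gvc; nlia.
  - by rewrite !inE eqxx orbF eq_sym Gne.
  - exact: NnW.
  move=> p q; rewrite !inE => /orP[/eqP-> qW|/andP[pc Gvp] qW]; first by rewrite Hv // inW -negb_or.
  have qW' : q \in W by rewrite inW -negb_or.
  by apply: Hcross => //; apply: contra pc => /covc.
(* The complement joins [W :\ c] to the m - 2 vertices of [v |: nb G v]. *)
have coverW c : c \in W -> (forall p, cross p -> p.2 == c) ->
    contains (compl G) (@Ti j m.+1).
  move=> cinW covc; have [|u] := @ex_notin _ W [:: c]; first by nlia.
  move=> uW; rewrite inE => uc.
  have HQ : {in W :\ c & v |: nb G v, forall p q, compl G p q}.
    move=> p q /setD1P[pc pW]; rewrite !inE symH => /orP[/eqP->|Gvq]; first exact: Hv.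
    by apply: Hcross => //; apply: contra pc => /covc.
  apply: (@contains_Ti_bip N m.+1 j (compl G) (W :\ c) (v |: nb G v) u v) => //.
  - by nlia.
  - by rewrite in_setD1 uc uW.
  - by apply: HQ; rewrite ?in_setD1 ?uc ?uW // !inE eqxx.
  - by rewrite setUA setUid cardsU1 inE irG; nlia.
  - by have := cardsD1 c W; rewrite cinW; nlia.
have [/existsP[p cp]|nocross] := boolP [exists p, cross p]; last first.
  have [|c] := @ex_notin _ (nb G v) [::]; first by nlia.
  rewrite inE => Gvc _; apply: (coverN c Gvc) => p cp.
  by case/negP: nocross; apply/existsP; exists p.
have [/existsP[q /andP[cq pq]]|cov1] := boolP [exists q, cross q && (q.1 != p.1)]; last first.
  have [/and3P[Gvp _ _]] := (cp); apply: (coverN _ Gvp) => q cq.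
  by apply: contraR cov1 => pq; apply/existsP; exists q; rewrite cq.
(* As [p] and [q] differ in [nb G v], they share their end in [W]. No [r] meets both in [nb G v], so
   [r] has that same end. *)
right; have [/and3P[_ pW _]] := (cp); apply: (coverW _ pW) => r cr.
have := noM _ _ cp cq; rewrite [_ == q.1]eq_sym (negPf pq) /= => /eqP ->.
have := noM _ _ cq cr => /orP[/eqP E|/eqP->//].
have := noM _ _ cp cr; rewrite -E [_ == q.1]eq_sym (negPf pq) /= => /eqP <-.
by have := noM _ _ cp cq; rewrite [_ == q.1]eq_sym (negPf pq) eq_sym.
Qed.

(** * The tree T_m^2 *)

Lemma T2_or_compl (N m j : nat) (G : rel 'I_N) v :
  simple_graph G -> 12 <= m -> N = 2 * m - 5 -> m - 3 <= #|nb G v| ->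
  contains G (@T2 m) \/ contains (compl G) (@Ti j m.+1).
Proof.
move=> sG m12 eN dv; have [symG irG] := sG.
have sH := compl_simple sG; have [symH irH] := sH.
have Gne a b : G a b -> a != b by apply: contraTneq => ->; rewrite irG.
have cW := card_nb_out v sG; set W := ~: _ in cW.
have inW w : (w \in W) = (w != v) && ~~ G v w by rewrite !inE negb_or.
have m5 : 5 <= m by apply: leq_trans m12.
have T2v x y z : G v x -> G x y -> G x z -> y != v -> z != v -> y != z ->
    m - 3 <= #|nb G v :\: [set t in [:: y; z]]| -> contains G (@T2 m).
  move=> Gvx Gxy Gxz yv zv yz; apply: (@contains_T2 N m G v x y z) => //.
  by have [vx xy xz] := And3 (Gne _ _ Gvx) (Gne _ _ Gxy) (Gne _ _ Gxz); distinct.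
have [dv1|dv2] := leqP (m - 1) #|nb G v|.
  (* With m - 1 neighbours, [v] can lose two of them, so any neighbour of degree 3 gives the
     tree. *)
  have [/existsP[x /andP[Gvx dx]]|noX] := boolP [exists x, G v x && (3 <= #|nb G x|)].
    have [|y] := @ex_notin _ (nb G x) [:: v]; first exact: ltnW.
    rewrite !inE => Gxy yv; have [|z] := @ex_notin _ (nb G x) [:: v; y]; first exact: dx.
    rewrite !inE negb_or => Gxz /andP[zv zy]; left; apply: (T2v x y z) => //.
      by rewrite eq_sym.
    by have := card_setD_seq (nb G v) [:: y; z]; nlia.
  have deg x : x \in nb G v -> #|nb G x| <= 2.
    rewrite inE => Gvx; rewrite leqNgt; apply: contra noX => dx.
    by apply/existsP; exists x; rewrite Gvx.
  have [|c cN _] := @ex_notin _ (nb G v) [::]; first by nlia.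
  right; have dc := deg c cN.
  apply: (@contains_Ti_compl_sparse N m j G c (nb G v)) => //; try by nlia.
  by move=> z /deg h; apply: leq_trans h _; nlia.
have [dv1|{dv2}dv] : #|nb G v| = m - 2 \/ #|nb G v| = m - 3 by nlia.
  (* Now [v] can lose only one neighbour, so one of the two vertices at distance two is taken in
     [W]. *)
  have [/existsP[x /existsP[w /and4P[Gvx wW Gxw dx]]]|noX] := boolP [exists x, exists w,
    [&& G v x, w \in W, G x w & 3 <= #|nb G x|]].
    have [|y] := @ex_notin _ (nb G x) [:: v; w]; first exact: dx.
    rewrite !inE negb_or => Gxy /andP[yv yw].
    move: wW; rewrite inW => /andP[wv nGvw]; left; apply: (T2v x y w) => //.
    have := card_setD_seq (nb G v) [:: y].
    suff /subset_leq_card : nb G v :\: [set t in [:: y]] \subset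
      nb G v :\: [set t in [:: y; w]] by nlia.
    apply/subsetP=> z; rewrite !inE negb_or => /andP[-> Gvz].
    by rewrite Gvz andbT; apply: contraTneq Gvz => ->.
  have deg x w : G v x -> w \in W -> G x w -> #|nb G x| <= 2.
    move=> Gvx wW Gxw; rewrite leqNgt; apply: contra noX => dx.
    by apply/existsP; exists x; apply/existsP; exists w; apply/and4P.
  (* A neighbour of [v] with an edge to [W] has degree at most 2; any other has all its neighbours
     in [v |: nb G v], so degree at most m - 1. *)
  right; have [/existsP[x /existsP[w /and3P[Gvx wW Gxw]]]|noE] :=
    boolP [exists x, exists w, [&& G v x, w \in W & G x w]].
    have dx := deg _ _ Gvx wW Gxw.
    apply: (@contains_Ti_compl_sparse N m j G x (nb G v)) => //; try by nlia.
    move=> z; rewrite inE => Gvz.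
    have [/existsP[u /andP[uW Gzu]]|noU] := boolP [exists u, (u \in W) && G z u].
      by apply: leq_trans (deg _ _ Gvz uW Gzu) _; nlia.
    have /subset_leq_card : nb G z \subset v |: nb G v.
      apply/subsetP=> u; rewrite inE => Gzu; apply: contraR noU => uN.
      by apply/existsP; exists u; rewrite Gzu inE uN.
    by rewrite cardsU1 inE irG; nlia.
  apply: (@contains_Ti_compl_sep N m j G v) => // x w Gvx wN.
  by apply: contra noE => Gxw; apply/existsP; exists x; apply/existsP; exists w; rewrite Gvx Gxw inE wN.
have cWm : #|W| = m - 3 by nlia.
have NnW x : G v x -> x \notin W by rewrite inW negb_and => ->; rewrite orbT.
have Hv w : w \in W -> compl G v w by rewrite inW /compl eq_sym.
(* With degree exactly m - 3, [v] can lose no neighbour: both vertices at distance two are taken in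
   [W]. *)
have [/existsP[x /andP[Gvx dx]]|noX] := boolP [exists x, G v x && (1 < #|nb G x :&: W|)].
  have /card_gt1P[y [z [/setIP[Gxy yW] /setIP[Gxz zW] yz]]] := dx.
  rewrite !inE in Gxy Gxz; move: yW zW; rewrite !inW => /andP[yv nGvy] /andP[zv nGvz].
  left; apply: (T2v x y z) => //; rewrite -dv; apply: subset_leq_card; apply/subsetP=> t.
  rewrite !inE negb_or => Gvt.
  by rewrite Gvt andbT; apply/andP; split; apply: contraTneq Gvt => ->.
have degW x : x \in nb G v -> #|nb G x :&: W| <= 1.
  rewrite inE => Gvx; rewrite leqNgt; apply: contra noX => dx.
  by apply/existsP; exists x; rewrite Gvx.
(* At most one vertex of [W] is adjacent to [x] and at most three are removed, leaving m - 7 or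
   more. The list [s] is for the vertices of [W] that lie in the set [D] of [outD]. *)
have Hout (x w : 'I_N) (s : seq 'I_N) : w \in W -> x \in nb G v -> size s <= 2 ->
    2 <= #|nb (compl G) x :&: W :\: [set z in w :: s]|.
  move=> wW xN szs; have xW : x \notin W by apply: NnW; rewrite inE in xN.
  have := card_setD_seq (W :\: nb G x) (w :: s).
  have := cardsID (nb G x) W; rewrite setIC; have := degW x xN.
  suff /subset_leq_card : W :\: nb G x :\: [set z in w :: s]
    \subset nb (compl G) x :&: W :\: [set z in w :: s] by nlia.
  apply: setSD; apply/subsetP=> z /setDP[zW]; rewrite in_setI zW andbT !inE /compl => ->.
  by rewrite andbT; apply: contraNneq xW => ->.
have outD (x w : 'I_N) (s : seq 'I_N) (D : {set 'I_N}) : 2 <= #|nb (compl G) x :&: W :\: [set z in w :: s]| ->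
    (forall z, z \in D -> z \in W -> z \in s) -> 2 <= #|nb (compl G) x :\: (w |: D)|.
  move=> le2 DW; apply: leq_trans le2 (subset_leq_card _); apply/subsetP=> z.
  case/setDP=> /setIP[Hz zW]; rewrite in_setD Hz andbT in_setU1 inE in_cons !negb_or.
  by case/andP=> -> zs; apply: contra zs => /DW; apply.
have [/existsP[w /andP[wW /forallP noN]]|allN] :=
  boolP [exists w, (w \in W) && [forall x, G v x ==> ~~ G x w]].
  right; have [|a aN _] := @ex_notin _ (nb G v) [::]; first by nlia.
  have [|b bN] := @ex_notin _ (nb G v) [:: a]; first by nlia.
  rewrite mem_seq1 eq_sym => ab.
  have out x : x \in nb G v -> 2 <= #|nb (compl G) x :\: (w |: (v |: nb G v))|.
    move=> xN; apply: (outD x w [::]); first exact: Hout.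
    by move=> z; rewrite !inE => ->.
  apply: (@contains_Ti_out N m.+1 j (compl G) w a b (v |: nb G v)) => //; try exact: out.
  - exact: leqW.
  - by rewrite in_setU1 aN orbT.
  - by rewrite in_setU1 bN orbT.
  - apply/subsetP=> z; rewrite !inE => /orP[/eqP->|Gvz]; first by rewrite symH Hv.
    rewrite /compl symG (implyP (noN z)) // andbT.
    by apply: contraTneq wW => ->; apply: NnW.
  - by rewrite cardsU1 inE irG; nlia.
have exN w : w \in W -> 0 < #|nb G w :&: nb G v|.
  move=> wW; rewrite card_gt0; apply: contra allN => /eqP E0.
  apply/existsP; exists w; rewrite wW; apply/forallP=> x; apply/implyP=> Gvx.
  by apply/negP=> Gxw; have /setP/(_ x) := E0; rewrite !inE Gvx symG Gxw.
(* With exN, this says that G induces a perfect matching between nb G v and W. *)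
have oneN w : w \in W -> #|nb G w :&: nb G v| <= 1.
  move=> wW; have sumW : #|W :\ w| <= \sum_(i in W | i != w) #|nb G i :&: nb G v|.
    rewrite -sum1_card (eq_bigl (fun i => (i \in W) && (i != w))) => [|i]; last first.
      by rewrite in_setD1 andbC.
    by apply: leq_sum => i /andP[iW _]; apply: exN.
  (* Each vertex of [nb G v] sends at most one edge to [W], so there are at most m - 3 edges, and
     the m - 4 vertices of [W] other than [w] use one each. *)
  have : \sum_(w in W) #|nb G w :&: nb G v| <= #|nb G v|.
    by rewrite sum_card_nb // -sum1_card; apply: leq_sum.
  rewrite (bigD1 w) //=; move/(leq_trans (leq_add (leqnn _) sumW)).
  by have := cardsD1 w W; rewrite wW; nlia.
have [/existsP[w /existsP[w' /and3P[wW w'W Hww']]]|clq] := boolP [exists w, exists w',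
  [&& w \in W, w' \in W & compl G w w']].
  right; have lA : m - 4 <= #|nb G v :\: nb G w|.
    by have := cardsID (nb G w) (nb G v); have := oneN w wW; rewrite setIC; nlia.
  have [|a aA _] := @ex_notin _ (nb G v :\: nb G w) [::]; first by nlia.
  have [|b bA] := @ex_notin _ (nb G v :\: nb G w) [:: a]; first by nlia.
  rewrite mem_seq1 eq_sym => ab.
  (* Adding [w'] makes up for the one neighbour that [w] may have in [nb G v]: |D| is at least m -
     2. *)
  pose D := w' |: (v |: (nb G v :\: nb G w)).
  have out x : x \in nb G v :\: nb G w -> 2 <= #|nb (compl G) x :\: (w |: D)|.
    case/setDP=> xN _; apply: (outD x w [:: w']); first exact: Hout.
    move=> z; rewrite mem_seq1 => /setU1P[->//|/setU1P[->|/setDP[]]].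
      by rewrite inW eqxx.
    by rewrite inE => /NnW/negPf->.
  apply: (@contains_Ti_out N m.+1 j (compl G) w a b D) => //; try exact: out.
  - exact: leqW.
  - by rewrite !in_setU1 aA !orbT.
  - by rewrite !in_setU1 bA !orbT.
  - apply/subsetP=> z; rewrite [in X in _ -> X]inE => /setU1P[->//|/setU1P[->|/setDP[]]].
      by rewrite symH Hv.
    rewrite !inE => Gvz nGwz; rewrite /compl nGwz andbT.
    by apply: contraTneq wW => ->; apply: NnW.
  - rewrite !cardsU1 !inE irG andbF /=.
    have -> : w' == v = false by apply/negbTE; move: w'W; rewrite inW => /andP[].
    by have := NnW w'; case: (G v w') => [/(_ isT)|_]; rewrite ?w'W // andbF; nlia.
have Gww w w' : w \in W -> w' \in W -> w != w' -> G w w'.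
  move=> wW w'W ww'; apply: contraR clq => nG; apply/existsP; exists w; apply/existsP; exists w'.
  by rewrite wW w'W /compl ww' nG.
(* [W] is now a clique, so [w] has m - 3 neighbours in [x |: (W :\ w)], and T_m^2 at [w] only needs
   [x] to have a neighbour [y] in [nb G v] besides [v]. Without it [x] has degree at most 2. *)
have [|w wW _] := @ex_notin _ W [::]; first by nlia.
have [|x] := @ex_notin _ (nb G w :&: nb G v) [::]; first exact: exN.
rewrite !inE => /andP[Gwx Gvx] _.
have [/existsP[y /andP[Gvy Gxy]]|noy] := boolP [exists y, G v y && G x y].
  left; have [vW yW] : v \notin W /\ y \notin W by split; [rewrite inW eqxx|apply: NnW].
  have [wv wy] : w != v /\ w != y by split; [apply: contraNneq vW|apply: contraNneq yW] => <-.
  apply: (@contains_T2 N m G w x v y) => //; last 1 first.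
  - have /subset_leq_card : x |: (W :\ w) \subset nb G w :\: [set z in [:: v; y]].
      apply/subsetP=> z /setU1P[->|/setD1P[zw zW]]; rewrite !inE negb_or.
        by rewrite Gwx eq_sym Gne // Gne.
      have wz : w != z by rewrite eq_sym.
      by rewrite Gww // andbT; apply/andP; split; [move: vW|move: yW]; apply: contraNneq => <-.
    have := cardsD1 w W; rewrite wW cardsU1 in_setD1 (negPf (NnW _ Gvx)) andbF; nlia.
  - by have [wx vx xy vy] := And4 (Gne _ _ Gwx) (Gne _ _ Gvx) (Gne _ _ Gxy) (Gne _ _ Gvy); distinct.
  - by rewrite symG.
right; have dx : #|nb G x| <= 2.
  have /subset_leq_card : nb G x \subset v |: nb G x :&: W.
    apply/subsetP=> z; rewrite inE => Gxz; rewrite in_setU1 in_setI inE Gxz inW.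
    case: eqVneq => //= zv; apply: contra noy => Gvz.
    by apply/existsP; exists z; rewrite Gvz.
  rewrite cardsU1; have := degW x; rewrite inE => /(_ Gvx); case: (v \notin _); nlia.
apply: (@contains_Ti_compl_sparse N m j G x (nb G v)) => //; try by nlia.
move=> z zN; have /subset_leq_card : nb G z :\: W \subset v |: nb G v.
  by apply/subsetP=> u /setDP[_]; rewrite inE negbK.
rewrite cardsU1 inE irG; have := cardsID W (nb G z); have := degW z zN; nlia.
Qed.

(** * The tree T_m^* *)

Lemma Tstar_hub (N m j : nat) (G : rel 'I_N) v :
  simple_graph G -> 12 <= m -> N = 2 * m - 5 -> m - 2 <= #|nb G v| ->
  contains G (@Tstar m) \/ contains (compl G) (@Ti j m.+1).
Proof.
move=> sG m12 eN dv; have [symG irG] := sG.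
have Gne a b : G a b -> a != b by apply: contraTneq => ->; rewrite irG.
have cW := card_nb_out v sG; set W := ~: _ in cW.
have inW w : (w \in W) = (w != v) && ~~ G v w by rewrite !inE negb_or.
have m5 : 5 <= m by apply: leq_trans m12.
(* The final disjunction ensures that [v] keeps m - 3 neighbours once [y] and [z] are removed. *)
have [/existsP[x /existsP[y /existsP[z /and5P[Gvx Gxy Gyz zx /and3P[yv zv ok]]]]]|noP] :=
  boolP [exists x, exists y, exists z, [&& G v x, G x y, G y z, z != x &
    [&& y != v, z != v & [|| m - 1 <= #|nb G v|, ~~ G v y | ~~ G v z]]]].
  left; apply: (@contains_Tstar N m G v x y z) => //.
    by have [vx xy yz] := And3 (Gne _ _ Gvx) (Gne _ _ Gxy) (Gne _ _ Gyz); distinct.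
  have /orP[dv1|nGv] := ok; first by have := card_setD_seq (nb G v) [:: y; z]; nlia.
  have [t le_t] : exists t, nb G v :\: [set u in [:: t]] \subset nb G v :\: [set u in [:: y; z]].
    case/orP: nGv => nGv; [exists z|exists y]; apply/subsetP=> u;
      rewrite !inE negb_or => /andP[-> Gvu]; rewrite Gvu ?andbT;
      by apply: contraTneq Gvu => ->.
  by have := card_setD_seq (nb G v) [:: t]; move/subset_leq_card: le_t; nlia.
have {}noP x y z : G v x -> G x y -> G y z -> z != x -> y != v -> z != v ->
    [|| m - 1 <= #|nb G v|, ~~ G v y | ~~ G v z] = false.
  move=> Gvx Gxy Gyz zx yv zv; apply: contraNF noP => ok.
  by apply/existsP; exists x; apply/existsP; exists y; apply/existsP; exists z; apply/and5P; rewrite yv zv.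
(* A common neighbour [y] of [v] and [x] would give the path [v], [y], [x], [w]. *)
have nbN x w : G v x -> w \in W -> G x w -> nb G x \subset ~: nb G v.
  rewrite inW => Gvx /andP[wv nGvw] Gxw; apply/subsetP=> y; rewrite !inE => Gxy.
  apply/negP=> Gvy; have := noP y x w Gvy; rewrite nGvw !orbT => H.
  suff: true = false by []; apply: H => //; first by rewrite symG.
    by apply: contraNneq nGvw => ->.
  by rewrite eq_sym Gne.
have cN : #|~: nb G v| = N - #|nb G v| by rewrite cardsCs setCK card_ord.
have [/existsP[x /existsP[w /and3P[Gvx wW Gxw]]]|noE] :=
  boolP [exists x, exists w, [&& G v x, w \in W & G x w]].
  (* A neighbour of [w] other than [x] would extend the path [v], [x], [w]. *)
  right; have dw : #|nb G w| <= 1.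
    rewrite -(cards1 x); apply/subset_leq_card/subsetP=> z; rewrite !inE => Gwz.
    move: wW; rewrite inW => /andP[wv nGvw]; apply: contraT => zx.
    have := noP x w z Gvx Gxw Gwz zx wv; rewrite nGvw orbT => H.
    by suff: true = false by []; apply: H; apply: contraNneq nGvw => <-; rewrite symG.
  apply: (@contains_Ti_compl_sparse N m j G w (nb G v)) => //; try by nlia.
  move=> z; rewrite inE => Gvz; case: (leqP (m - 1) #|nb G v|) => dv1; last first.
    have [/existsP[u /andP[uW Gzu]]|noU] := boolP [exists u, (u \in W) && G z u].
      by have /subset_leq_card := nbN _ _ Gvz uW Gzu; nlia.
    have /subset_leq_card : nb G z \subset v |: nb G v.
      apply/subsetP=> u; rewrite inE => Gzu; apply: contraR noU => uN.
      by apply/existsP; exists u; rewrite Gzu inE uN.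
    by rewrite cardsU1 inE irG; nlia.
  (* If [z] is adjacent to [y] in [nb G v], the excluded paths [v], [y], [z], [u] leave [z] only the
     neighbours [v] and [y]. *)
  have [/existsP[y /andP[Gvy Gzy]]|noY] := boolP [exists y, G v y && G z y].
    have /subset_leq_card : nb G z \subset [:: v; y].
      apply/subsetP=> u; rewrite !inE => Gzu; apply: contraT; rewrite negb_or => /andP[uv uy].
      have := noP y z u Gvy; rewrite dv1 => H.
      suff: true = false by []; apply: H => //; first by rewrite symG.
      by rewrite eq_sym Gne.
    by move/leq_trans/(_ (card_size _)) => /=; nlia.
  have /subset_leq_card : nb G z \subset ~: nb G v.
    apply/subsetP=> u; rewrite !inE => Gzu; apply: contra noY => Gvu.
    by apply/existsP; exists u; rewrite Gvu.
  by nlia.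
right; have {}noE x w : G v x -> w \notin v |: nb G v -> ~~ G x w.
  move=> Gvx wN; apply: contra noE => Gxw.
  by apply/existsP; exists x; apply/existsP; exists w; rewrite Gvx Gxw inE wN.
case: (leqP (m - 1) #|nb G v|) => dv1; last first.
  by apply: (@contains_Ti_compl_sep N m j G v) => //; nlia.
have deg x : x \in nb G v -> #|nb G x| <= 2.
  rewrite inE => Gvx.
  have [/existsP[y /andP[Gvy Gxy]]|noY] := boolP [exists y, G v y && G x y].
    have /subset_leq_card : nb G x \subset [:: v; y].
      apply/subsetP=> u; rewrite !inE => Gxu; apply: contraT; rewrite negb_or => /andP[uv uy].
      have := noP y x u Gvy; rewrite dv1 => H.
      suff: true = false by []; apply: H => //; first by rewrite symG.
      by rewrite eq_sym Gne.
    by move/leq_trans/(_ (card_size _)).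
  have /subset_leq_card : nb G x \subset [set v].
    apply/subsetP=> u; rewrite !inE => Gxu; apply: contraR noY => uv.
    apply/existsP; exists u; rewrite Gxu andbT; apply: contraLR Gxu => nGvu.
    by apply: noE => //; rewrite !inE negb_or uv.
  by rewrite cards1; nlia.
have [|c cc _] := @ex_notin _ (nb G v) [::]; first by nlia.
have dc := deg c cc; apply: (@contains_Ti_compl_sparse N m j G c (nb G v)) => //; try by nlia.
by move=> z /deg h; apply: leq_trans h _; nlia.
Qed.

Lemma Tstar_or_compl (N m j : nat) (G : rel 'I_N) v :
  simple_graph G -> 12 <= m -> N = 2 * m - 5 -> m - 3 <= #|nb G v| ->
  contains G (@Tstar m) \/ contains (compl G) (@Ti j m.+1).
Proof.
move=> sG m12 eN dv; have [symG irG] := sG.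
have sH := compl_simple sG; have [symH irH] := sH.
have Gne a b : G a b -> a != b by apply: contraTneq => ->; rewrite irG.
have [/existsP[u du]|/existsPn max] := boolP [exists u, m - 2 <= #|nb G u|].
  exact: Tstar_hub du.
have {max}degG x : #|nb G x| <= m - 3 by have := max x; rewrite -ltnNge; nlia.
have {}dv : #|nb G v| = m - 3 by have := degG v; nlia.
have cW := card_nb_out v sG; set W := ~: _ in cW.
have inW w : (w \in W) = (w != v) && ~~ G v w by rewrite !inE negb_or.
have m5 : 5 <= m by apply: leq_trans m12.
(* All degrees being at most m - 3 <= 2m - 10, a single vertex of degree at most m - 6 suffices;
   hence all degrees lie between m - 5 and m - 3. *)
have [/existsP[c dc]|/existsPn min] := boolP [exists c, #|nb G c| <= m - 6].
  right; apply: (@contains_Ti_compl_sparse N m j G c setT) => //.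
    by rewrite cardsT card_ord; nlia.
  by move=> x _; apply: leq_trans (degG x) _; nlia.
have {min}degG5 x : m - 5 <= #|nb G x| by have := min x; rewrite -ltnNge; nlia.
have cWm : #|W| = m - 3 by nlia.
have vW : v \notin W by rewrite inW eqxx.
have NnW x : G v x -> x \notin W by rewrite inW negb_and => ->; rewrite orbT.
have Hv w : w \in W -> compl G v w by rewrite inW /compl eq_sym.
have [/existsP[x /existsP[y /existsP[z /and5P[Gvx Gxy Gyz yW zW]]]]|noP] :=
  boolP [exists x, exists y, exists z, [&& G v x, G x y, G y z, y \in W & z \in W]].
  left; move: (yW) (zW); rewrite !inW => /andP[yv nGvy] /andP[zv nGvz].
  apply: (@contains_Tstar N m G v x y z) => //.
    have [vx xy yz] := And3 (Gne _ _ Gvx) (Gne _ _ Gxy) (Gne _ _ Gyz).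
    have xz : x != z by apply: contraNneq nGvz => <-.
    by distinct.
  rewrite -dv; apply: subset_leq_card; apply/subsetP=> t; rewrite !inE negb_or => Gvt.
  by rewrite Gvt andbT; apply/andP; split; apply: contraTneq Gvt => ->.
have {}noP x y z : G v x -> G x y -> G y z -> y \in W -> z \in W -> False.
  move=> Gvx Gxy Gyz yW zW; case/negP: noP.
  by apply/existsP; exists x; apply/existsP; exists y; apply/existsP; exists z; apply/and5P.
have [/existsP[w /andP[wW /forallP noN]]|allN] :=
  boolP [exists w, (w \in W) && [forall x, G v x ==> ~~ G x w]].
  right; have [|b bN _] := @ex_notin _ (nb G v) [::]; first by nlia.
  rewrite inE in bN.
  have nbw z : G w z -> z \in W.
    move=> Gwz; rewrite inW; apply/andP; split.
      by apply: contraTneq Gwz => ->; move: wW; rewrite symG inW => /andP[].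
    by apply/negP=> Gvz; have := implyP (noN z) Gvz; rewrite symG Gwz.
  have nbwH z x : G w z -> G v x -> compl G x z.
    move=> Gwz Gvx; have zW := nbw z Gwz; rewrite /compl; apply/andP; split.
      by apply: contraTneq zW => <-; apply: NnW.
    by apply/negP=> Gxz; apply: (noP x z w) => //; rewrite symG.
  (* The outside vertices are the neighbours of [w] in [G]: they lie in [W], and an edge from
     [nb G v] to one of them would give a path excluded by [noP]. *)
  have out x : (forall z, G w z -> compl G x z) ->
      2 <= #|nb (compl G) x :\: (w |: (v |: nb G v))|.
    move=> Hx; apply: leq_trans (_ : #|nb G w| <= _); first by apply: leq_trans (degG5 w); nlia.
    apply/subset_leq_card/subsetP=> z; rewrite inE => Gwz.
    have := nbw z Gwz; rewrite in_setD !in_setU1 !inE => /negPf->.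
    by rewrite Hx // andbT orbF eq_sym Gne.
  apply: (@contains_Ti_out N m.+1 j (compl G) w v b (v |: nb G v)) => //.
  - exact: leqW.
  - exact: Gne.
  - by rewrite in_setU1 eqxx.
  - by rewrite in_setU1 inE bN orbT.
  - apply/subsetP=> z; rewrite !inE => /orP[/eqP->|Gvz]; first by rewrite symH Hv.
    rewrite /compl symG (implyP (noN z)) // andbT.
    by apply: contraTneq wW => ->; apply: NnW.
  - by rewrite cardsU1 inE irG; nlia.
  - by apply: out => z /nbw/Hv.
  - by apply: out => z Gwz; apply: nbwH.
(* Every [w] in [W] now has a neighbour in [nb G v], so an edge inside [W] would complete an
   excluded path. *)
have indW w w' : w \in W -> w' \in W -> ~~ G w w'.
  move=> wW w'W; apply: contra allN => Gww; apply/existsP; exists w; rewrite wW.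
  apply/forallP=> x; apply/implyP=> Gvx; apply/negP=> Gxw; exact: (noP x w w').
have nbW w z : w \in W -> G w z -> G v z.
  move=> wW Gwz; have := contraTN (indW w z wW) Gwz; rewrite inW negb_and !negbK.
  case/orP=> // /eqP zv; move: wW Gwz; rewrite zv inW symG => /andP[_ /negPf->] //.
(* Now v |: W is independent in G, and two of its vertices w1, w2 have more than
   |nb G v| neighbours in total, hence a common one. *)
have [|w1 w1W _] := @ex_notin _ W [::]; first by nlia.
have [|w2 w2W] := @ex_notin _ W [:: w1]; first by nlia.
rewrite mem_seq1 => w21.
have [|x] := @ex_notin _ (nb G w1 :&: nb G w2) [::].
  have : #|nb G w1 :|: nb G w2| <= #|nb G v|.
    by apply/subset_leq_card/subsetP=> z; rewrite !inE => /orP[]; apply: nbW.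
  by rewrite cardsU; have := degG5 w1; have := degG5 w2; nlia.
rewrite !inE => /andP[Gw1x Gw2x] _; have Gvx := nbW _ _ w1W Gw1x.
have vx : 0 < #|nb G x :\: W|.
  by apply/card_gt0P; exists v; rewrite in_setD vW inE symG.
have [dx|dx] := leqP #|nb G x| (m - 4).
  (* As [v] is one of the at most m - 4 neighbours of [x], two vertices of [W] are not adjacent to
     [x]. In the complement both are joined to [v] and [w1], which are not complement neighbours of
     [x]. *)
  right; have lA : 2 <= #|W :\: nb G x|.
    by have := cardsID (nb G x) W; have := cardsID W (nb G x); rewrite setIC; nlia.
  have /card_gt1P[a [b [/setDP[aW nGxa] /setDP[bW nGxb] ab]]] := lA.
  rewrite !inE in nGxa nGxb.
  have Hx a' : a' \in W -> ~~ G x a' -> compl G x a'.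
    move=> aW' nG; rewrite /compl nG andbT.
    by apply: contraTneq aW' => <-; apply: NnW.
  have out a' : a' \in W -> ~~ G x a' -> 2 <= #|nb (compl G) a' :\: (x |: nb (compl G) x)|.
    move=> aW' nGa; apply/card_gt1P; exists v, w1; split; rewrite ?in_setD ?in_setU1 ?inE.
    - have -> : compl G x v = false by rewrite /compl symG Gvx andbF.
      by rewrite (negPf (Gne _ _ Gvx)) symH Hv.
    - have -> : compl G x w1 = false by rewrite /compl symG Gw1x andbF.
      rewrite (negPf (Gne _ _ Gw1x)) /compl indW // andbT.
      by apply: contraNneq nGa => ->; rewrite symG.
    - by apply: contraNneq vW => ->.
  apply: (@contains_Ti_out N m.+1 j (compl G) x a b (nb (compl G) x)) => //; try exact: out.
  - exact: leqW.
  - by rewrite inE Hx.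
  - by rewrite inE Hx.
  - by have := card_nb_compl x sG; nlia.
have {}dx : #|nb G x| = m - 3 by have := degG x; nlia.
left; have [|w0] := @ex_notin _ (W :\: nb G x) [::].
  by have := cardsID (nb G x) W; have := cardsID W (nb G x); rewrite setIC; nlia.
case/setDP=> w0W; rewrite inE => nGxw0 _.
(* Otherwise [x] is adjacent to [v], [w1], [w2] and at least m - 5 neighbours of [w0], too many. The
   path [x], [v], [x1], [w0] then costs [x] none of its m - 3 neighbours other than [v], which it
   uses as a branch. *)
have [x1 Gx1 nGxx1] : exists2 x1, G w0 x1 & ~~ G x x1.
  have [/existsP[x1 /andP[Gx1 nGxx1]]|/existsPn sub] := boolP [exists x1, G w0 x1 && ~~ G x x1].
    by exists x1.
  have : #|v |: (w1 |: (w2 |: nb G w0))| <= #|nb G x|.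
    apply/subset_leq_card/subsetP=> z; rewrite !inE.
    case/or4P=> [/eqP->|/eqP->|/eqP->|Gz]; try by rewrite symG.
    by have := sub z; rewrite Gz negbK.
  have nw0 w : w \in W -> G w0 w = false by move=> wW; apply/negbTE/indW.
  have vw w : w \in W -> (v == w) = false.
    by move=> wW; apply/negbTE; apply: contraNneq vW => ->.
  have nw0v : G w0 v = false by rewrite symG; move: w0W; rewrite inW => /andP[_ /negPf].
  rewrite !cardsU1 !inE !vw // nw0v !nw0 // eq_sym (negPf w21) /=.
  by have := degG5 w0; nlia.
have Gvx1 := nbW _ _ w0W Gx1.
apply: (@contains_Tstar N m G x v x1 w0) => //; try by rewrite symG.
  have xx1 : x != x1 by apply: contraNneq nGxw0 => ->; rewrite symG.
  have xw0 : x != w0 by apply: contraTneq w0W => <-; apply: NnW.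
  have vw0 : v != w0 by apply: contraNneq vW => ->.
  by have [vx' vx1 w0x1] := And3 (Gne _ _ Gvx) (Gne _ _ Gvx1) (Gne _ _ Gx1); distinct.
rewrite -dx; apply: subset_leq_card; apply/subsetP=> t; rewrite !inE negb_or => Gxt.
by rewrite Gxt andbT; apply/andP; split; apply: contraTneq Gxt => ->.
Qed.

(** * The lower bound *)

Lemma contains_max_degree (N n : nat) (R : rel 'I_N) (a : nat -> nat -> bool) :
  3 <= n -> (forall j, 1 <= j <= n - 3 -> a 0 j) -> contains R (@sym_edges n a) ->
  exists v, n - 3 <= #|nb R v|.
Proof.
move=> n3 a0 [f [inj_f fR]]; have n0 : 0 < n by apply: leq_trans n3.
have ltn (k : 'I_(n - 3)) : k.+1 < n by have := ltn_ord k; nlia.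
pose g k := f (Ordinal (ltn k)); exists (f (Ordinal n0)).
have inj_g : injective g by move=> k l /inj_f[/val_inj].
rewrite -[n - 3]card_ord -(card_codom inj_g); apply/subset_leq_card/subsetP=> y.
case/codomP=> k ->; rewrite inE; apply: fR; by rewrite /sym_edges a0 //=.
Qed.

Lemma contains_Ti_max_degree (N n j : nat) (R : rel 'I_N) :
  3 <= n -> contains R (@Ti j n) -> exists v, n - 3 <= #|nb R v|.
Proof.
by rewrite /Ti => n3; case: ifP => _; apply: contains_max_degree => // k /= ->.
Qed.

Lemma contains_Tstar_max_degree (N n : nat) (R : rel 'I_N) :
  3 <= n -> contains R (@Tstar n) -> exists v, n - 3 <= #|nb R v|.
Proof. by move=> n3; apply: contains_max_degree => // k /= ->. Qed.

(** Position of [x] within its side; [x] and [x + k] are the partners in the removed matching. *)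
Definition bip_mod (k x : nat) : nat := if x < k then x else x - k.

(* K_{k,k} minus a perfect matching, induced on its first M vertices (M <= 2k). *)
Definition bip_graph (k M : nat) : rel 'I_M :=
  fun x y => ((x < k) != (y < k)) && (bip_mod k x != bip_mod k y).

Lemma bip_graph_simple (k M : nat) : simple_graph (@bip_graph k M).
Proof.
split=> [x y|x]; last by rewrite /bip_graph eqxx.
by rewrite /bip_graph eq_sym [_ == bip_mod k y]eq_sym.
Qed.

(** The position map is injective on the neighbours of [x], all on the other side, and misses the
    position of [x]. It is also injective on the complement neighbours: only the partner of [x] has
    its position, the others lying on the side of [x]. *)
Lemma bip_graph_degree (k M : nat) (x : 'I_M) : 0 < k -> M <= 2 * k ->
  #|nb (@bip_graph k M) x| < k /\ #|nb (compl (@bip_graph k M)) x| <= k.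
Proof.
move=> k0 leM; have lt_mod (y : 'I_M) : bip_mod k y < k.
  by rewrite /bip_mod; case: (ltnP y k) => // ky; have := ltn_ord y; nlia.
pose p y := Ordinal (lt_mod y).
have modE (y z : 'I_M) : p y = p z -> (y < k) = (z < k) -> y = z.
  move=> [e] s; apply/val_inj; move: e s => /=; rewrite /bip_mod.
  by case: (ltnP y k) => ?; case: (ltnP z k) => // ? e _; nlia.
split.
  rewrite -{2}(card_ord k) -cardsT (cardsD1 (p x)) in_setT add1n ltnS.
  rewrite -(card_in_imset (f := p)) => [|y z].
    apply/subset_leq_card/subsetP=> _ /imsetP[y yx ->]; rewrite !inE andbT.
    by move: yx; rewrite inE => /andP[_]; rewrite eq_sym.
  rewrite !inE => /andP[xy _] /andP[xz _] /modE; apply.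
  by move: xy xz; do 3!case: (_ < k).
rewrite -{2}(card_ord k) -(card_in_imset (f := p)) ?max_card // => y z.
have side t : compl (@bip_graph k M) x t -> p t = p x -> (t < k) = ~~ (x < k).
  case/andP=> xt _ /modE; case: (t < k); case: (x < k) => // /(_ erefl) tx.
    by rewrite tx eqxx in xt.
  by rewrite tx eqxx in xt.
have other t : compl (@bip_graph k M) x t -> p t != p x -> (t < k) = (x < k).
  case/andP=> _; rewrite negb_and !negbK => /orP[/eqP//|/eqP E] /negP[].
  by apply/eqP/val_inj.
rewrite !inE => xy xz E; apply: (modE _ _ E).
have [Ey|Ey] := eqVneq (p y) (p x); last by rewrite (other y) // (other z) // -E.
by rewrite (side y) // (side z) // -E.
Qed.

(** * Combining the bounds *)

Lemma tree_or_compl (m i j N : nat) (G : rel 'I_N) : 12 <= m -> N = 2 * m - 5 -> simple_graph G ->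
  (contains G (@Ti i m) \/ contains (compl G) (@Ti j m.+1)) /\
  (contains G (@Tstar m) \/ contains (compl G) (@Ti j m.+1)).
Proof.
move=> m12 eN sG.
have [/existsP[v dv]|/existsPn small] := boolP [exists v, m - 3 <= #|nb G v|].
  split; last exact: Tstar_or_compl dv.
  by rewrite {1}/Ti; case: ifP => _; [apply: T1_or_compl dv|apply: T2_or_compl dv].
suff H : contains (compl G) (@Ti j m.+1) by split; right.
apply: contains_Ti_min_degree; [exact: compl_simple|by []|by nlia|move=> v].
by have := small v; rewrite -ltnNge; have := card_nb_compl v sG; nlia.
Qed.

(** M is at most 2(m - 3), so the first M vertices of the bipartite example are available. *)
Lemma not_ramsey_prop_below (n1 n2 m M : nat) (H1 : rel 'I_n1) (H2 : rel 'I_n2) : 12 <= m -> M < 2 * m - 5 ->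
  (forall (N : nat) (R : rel 'I_N), contains R H1 -> exists v, m - 3 <= #|nb R v|) ->
  (forall (N : nat) (R : rel 'I_N), contains R H2 -> exists v, m - 2 <= #|nb R v|) ->
  ~ ramsey_prop H1 H2 M.
Proof.
move=> m12 ltM deg1 deg2 /(_ _ (@bip_graph_simple (m - 3) M)).
have deg x : #|nb (@bip_graph (m - 3) M) x| < m - 3 /\
    #|nb (compl (@bip_graph (m - 3) M)) x| <= m - 3.
  by apply: bip_graph_degree; nlia.
by case=> [/deg1|/deg2] [v]; have [] := deg v; nlia.
Qed.

Theorem theorem6p5 (m i j : nat) (hm : 12 <= m)
  (hi : (i == 1) || (i == 2)) (hj : (j == 1) || (j == 2)) :
  is_ramsey_number (@Ti i m) (@Ti j m.+1) (2 * m - 5) /\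
  is_ramsey_number (@Tstar m) (@Ti j m.+1) (2 * m - 5).
Proof.
have n3 : 3 <= m by apply: leq_trans hm.
have deg2 N (R : rel 'I_N) : contains R (@Ti j m.+1) -> exists v, m - 2 <= #|nb R v|.
  by move/contains_Ti_max_degree=> []; first exact: leqW; move=> v dv; exists v.
split; (split; first by nlia); split.
- by move=> G sG; have [] := @tree_or_compl m i j _ G hm erefl sG.
- move=> M _ ltM; apply: (not_ramsey_prop_below hm ltM) => // N R; exact: contains_Ti_max_degree.
- by move=> G sG; have [] := @tree_or_compl m i j _ G hm erefl sG.
- move=> M _ ltM; apply: (not_ramsey_prop_below hm ltM) => // N R; exact: contains_Tstar_max_degree.
Qed.
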